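(* Let $q,q'$ be indeterminates. For every positive integer $n$, \[(n+1)\,\mathcal{C}_n(q')=\sum_{k=0}^n\mathcal{C}_{n-k}(q)\sum_{\substack{i,j\ge0\\ i+j\le k}}(1-q)^i(q'-1)^j\binom{n-k+i}{i}\binom{n+1}{j}\binom{2k-i-j-1}{k-i-j}.\]
   Context: The Narayana polynomials are $C_0(q)=1$ and $C_n(q)=\sum_{k=1}^n \frac1n\binom{n}{k-1}\binom{n}{k}q^{k-1}$ for $n\ge1$; the large Narayana polynomials are $\mathcal{C}_0(q)=1$ and $\mathcal{C}_n(q)=q\,C_n(q)$ for $n\ge1$. Binomial coefficients $\binom{x}{k}$ with integer $k\ge0$ and arbitrary (possibly negative) integer $x$ mean $x(x-1)\cdots(x-k+1)/k!$ (so $\binom{-1}{0}=1$). *)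

(* Defs.v *)
From HB Require Import structures.
From mathcomp Require Import all_boot all_order all_algebra.
From mathcomp Require Import mpoly.

Set Implicit Arguments.
Unset Strict Implicit.
Unset Printing Implicit Defensive.

Import GRing.Theory.
Local Open Scope ring_scope.

Definition narayana (n : nat) : {poly rat} :=
  if n is 0 then 1
  else \sum_(1 <= k < n.+1)
         (n%:R^-1 * 'C(n, k.-1)%:R * 'C(n, k)%:R) *: 'X^(k.-1).

Definition large_narayana (n : nat) : {poly rat} :=
  if n is 0 then 1 else 'X * narayana n.

Definition large_narayana_at (A : comAlgType rat) (n : nat) (x : A) : A :=
  horner_alg x (large_narayana n).

(* Unlike 'C(_, _), the upper argument may be negative: gbin (-1) 0 = 1. *)
Definition gbin (x : int) (k : nat) : rat :=
  (\prod_(i < k) (x - i%:Z))%:~R / k`!%:R.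

(* Main.v *)
(* Put [a = 1 - q] and [phi_x = (1 + (x - 1) X) / (1 - X)]. Reading each binomial
   coefficient as a coefficient of a power of a geometric series, the inner sum
   is [X^k] phi_q'^(n+1) phi_q^-(n-k+1), and a direct computation gives
   [X^n] phi_x^(n+1) = (n+1) C_n(x), C_n being the large Narayana
   polynomial. By Lagrange inversion the latter says that the sum over m of C_m(q) X^m phi_q^-(m+1) is 1, so the right-hand side
   collapses to [X^n] phi_q'^(n+1), which is the left-hand side.
   Power series are represented by polynomials compared modulo a power of X. *)
Require Import Defs.
From HB Require Import structures.
From mathcomp Require Import all_boot all_order all_algebra.
From mathcomp Require Import mpoly.
From mathcomp Require Import zify ring.

Import GRing.Theory.
Local Open Scope ring_scope.

(** * Congruence of polynomials modulo a power of [X] *)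

Definition eq_upto {K : nzRingType} (N : nat) (P Q : {poly K}) :=
  forall i, (i < N)%N -> P`_i = Q`_i.

Lemma eq_uptoM {K : nzRingType} {N : nat} {P P' Q Q' : {poly K}} :
  eq_upto N P P' -> eq_upto N Q Q' -> eq_upto N (P * Q) (P' * Q').
Proof.
move=> PP QQ i iN; rewrite !coefM; apply: eq_bigr => j _.
by rewrite PP ?QQ //; have := ltn_ord j; lia.
Qed.

Lemma eq_uptoX {K : nzRingType} {N : nat} {P P' : {poly K}} (m : nat) :
  eq_upto N P P' -> eq_upto N (P ^+ m) (P' ^+ m).
Proof. by move=> PP; elim: m => [|m IH] //; rewrite !exprS; apply: eq_uptoM. Qed.

Lemma mulr_ratnat {K : comAlgType rat} (m : nat) (x : K) :
  m%:R * x = (m%:R : rat) *: x.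
Proof. by rewrite scaler_nat mulr_natl. Qed.

Lemma natmul_ratI {K : comAlgType rat} (m : nat) (x y : K) :
  m.+1%:R * x = m.+1%:R * y -> x = y.
Proof.
rewrite !mulr_ratnat => /(congr1 ( *:%R (m.+1%:R^-1 : rat))).
by rewrite !scalerA mulVf ?Num.Theory.pnatr_eq0 // !scale1r.
Qed.

Lemma coefXderiv {K : nzRingType} (P : {poly K}) (i : nat) :
  ('X * P^`())`_i = P`_i *+ i.
Proof. by rewrite coefXM coef_deriv; case: i. Qed.

(** * Lagrange inversion by residues *)

Section Lagrange.
Variables (K : comAlgType rat) (N : nat) (phi psi : {poly K}).
Hypotheses (phi0 : phi`_0 = 1) (phi_psi : eq_upto N (phi * psi) 1).

Lemma eq_upto_mul_exp (m d : nat) :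
  eq_upto N (phi ^+ (m + d) * psi ^+ m) (phi ^+ d).
Proof.
rewrite exprD mulrAC -exprMn -[X in eq_upto _ _ X]mul1r -(expr1n _ m).
by apply: eq_uptoM => //; apply: eq_uptoX.
Qed.

(** Leibniz rule applied to [phi * psi = 1]. Differentiation costs one order of precision, and the
    factor ['X] restores it. *)
Lemma Xderiv_inverse :
  eq_upto N (phi * ('X * psi^`())) (- ('X * phi^`() * psi)).
Proof.
move=> i iN; apply/eqP; rewrite coefN -addr_eq0 -coefD.
have -> : phi * ('X * psi^`()) + 'X * phi^`() * psi = 'X * (phi * psi)^`().
  by rewrite derivM; ring.
by rewrite coefXderiv phi_psi // coef1; case: (i) => //= j; rewrite mul0rn.
Qed.

(* [(X P)' = P + X P'], and for [P = X^m psi^(m+1)] the residue of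
   [(X P)' / (X psi)^(p+1)] vanishes unless [m = p]. *)
Lemma coef_residue (m p : nat) : (p < N)%N ->
  (phi ^+ p.+1 * ('X * ('X^m * psi ^+ m.+1))^`())`_p = p.+1%:R *+ (m == p).
Proof.
move=> pN.
(* The differentiated polynomial is [('X * psi) ^+ m.+1]. *)
have -> : ('X * ('X^m * psi ^+ m.+1))^`()
    = 'X^m * (psi ^+ m * (psi + 'X * psi^`())) *+ m.+1.
  by rewrite mulrA -exprS -exprMn deriv_exp derivM derivX /= exprMn; ring.
rewrite mulrnAr coefMn mulrCA coefXnM.
have [pm|mp] := ltnP p m; first by rewrite mul0rn; case: eqP => //; lia.
have {mp} [d dE] : exists d, p = (m + d)%N by exists (p - m)%N; lia.
rewrite dE addKn; have dN : (d < N)%N by lia.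
have -> : (phi ^+ (m + d).+1 * (psi ^+ m * (psi + 'X * psi^`())))`_d
   = (phi ^+ d + phi ^+ d * (phi * ('X * psi^`())))`_d.
  rewrite -addnS mulrA (eq_uptoM (eq_upto_mul_exp m d.+1) (fun i _ => erefl)) //.
  rewrite mulrDr coefD [RHS]coefD; congr (_ + _); last by rewrite exprSr mulrA.
  exact: (eq_upto_mul_exp 1 d).
case: d dN {dE} => [|d] dN.
  rewrite expr0 mul1r coefD coef1 coefM big_ord1 subn0 coefXM mulr0 addr0.
  by rewrite addn0 eqxx.
rewrite (_ : m == (m + d.+1)%N = false) ?mulr0n; last by apply/eqP; lia.
suff -> : (phi ^+ d.+1 + phi ^+ d.+1 * (phi * ('X * psi^`())))`_d.+1 = 0.
  by rewrite mul0rn.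
rewrite coefD (eq_uptoM (fun i _ => erefl) Xderiv_inverse) //.
rewrite mulrN coefN (_ : phi ^+ d.+1 * _ =
  phi ^+ d.+1 * psi ^+ 1 * ('X * phi^`())); last by ring.
have := eq_upto_mul_exp 1 d; rewrite add1n => h.
rewrite (eq_uptoM h (fun i _ => erefl)) //.
(* Multiplied by [d.+1], the subtracted polynomial becomes [X] times the derivative of
   [phi ^+ d.+1], and [X d/dX] multiplies the coefficient of degree [d.+1] by [d.+1]. *)
apply: (@natmul_ratI _ d); rewrite mulr0 mulrBr; apply/eqP; rewrite subr_eq0.
apply/eqP; rewrite !mulr_natl -coefXderiv deriv_exp /= -coefMn.
suff -> : 'X * (phi^`() * phi ^+ d *+ d.+1) = phi ^+ d * ('X * phi^`()) *+ d.+1.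
  by [].
by ring.
Qed.

(* Lagrange inversion: [\sum_m c_m (X psi)^(m+1) = X] when [phi = 1 / psi] and
   [c_m = [X^m] phi^(m+1) / (m+1)]. *)
Lemma lagrange_inversion (c : nat -> K) :
  (forall m, (m < N)%N -> m.+1%:R * c m = (phi ^+ m.+1)`_m) ->
  eq_upto N (\sum_(m < N) c m *: ('X^m * psi ^+ m.+1)) 1.
Proof.
move=> cE; set S := \sum_(m < N) _.
suff T0 : eq_upto N (S - 1) 0.
  by move=> i iN; apply/eqP; rewrite -subr_eq0 -coefB T0 // coef0.
(* By [coef_residue] only the term [m = p] of [S] contributes, and [c p] is chosen so that it
   cancels the contribution of [1]. *)
have key p : (p < N)%N -> (phi ^+ p.+1 * ('X * (S - 1))^`())`_p = 0.
  move=> pN; rewrite mulrBr mulr1 derivB derivX mulrBr mulr1 coefB -cE //.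
  rewrite /S mulr_sumr raddf_sum mulr_sumr coef_sum.
  rewrite (bigD1 (Ordinal pN)) //= big1 => [|m mp].
    by rewrite addr0 -scalerAr derivZ -scalerAr coefZ coef_residue // eqxx mulrC subrr.
  rewrite -scalerAr derivZ -scalerAr coefZ coef_residue //.
  rewrite (_ : (m : nat) == p = false) ?mulr0 //.
  by apply/eqP => e; case/eqP: mp; apply: val_inj.
(* The equations [key] are triangular in the coefficients of [T]: once the lower ones vanish, the
   [p]-th equation reads [p.+1 * T_p = 0], because [phi] has constant term 1. *)
move: (S - 1) key => T key; elim/ltn_ind => p IH pN.
have := key p pN; rewrite coefM big_ord_recl big1 => [|i _].
  rewrite addr0 subn0 coef_deriv coefXM /= -horner_coef0 horner_exp.
  rewrite horner_coef0 phi0 expr1n mul1r coef0 -mulr_natl => Tp0.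
  by apply: (@natmul_ratI _ p); rewrite mulr0.
have ip := ltn_ord i.
by rewrite coef_deriv coefXM /= IH ?coef0 ?mul0rn ?mulr0 // /bump /=; lia.
Qed.
End Lagrange.

(** * Coefficients of powers of geometric series and of linear factors *)

Section Geometric.
Variables (K : comNzRingType) (N : nat).

Definition geom (c : K) : {poly K} := \poly_(i < N) c ^+ i.

Lemma geom_inverse (c : K) : eq_upto N ((1 - c *: 'X) * geom c) 1.
Proof.
move=> i iN; rewrite mulrBl mul1r -scalerAl coefB coefZ coefXM !coef_poly iN coef1.
case: i iN => [|i] iN; first by rewrite mulr0 subr0.
by rewrite (ltnW iN) -exprS subrr.
Qed.

Lemma sum_bin_diag (m i : nat) :
  (\sum_(l < i.+1) 'C(m + l, l))%N = 'C(m.+1 + i, i).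
Proof.
elim: i => [|i IH]; first by rewrite big_ord1 !bin0.
by rewrite big_ord_recr /= IH [in RHS]addSn binS addnC addSnnS.
Qed.

(** Negative binomial series: each further geometric factor replaces the coefficients by
    hockey-stick sums. Truncation does not affect degrees below [N]. *)
Lemma coef_geom_exp (c : K) (m i : nat) : (i < N)%N ->
  (geom c ^+ m.+1)`_i = 'C(m + i, i)%:R * c ^+ i.
Proof.
elim: m i => [|m IH] i iN; first by rewrite coef_poly iN binn mul1r.
rewrite exprSr coefM -sum_bin_diag natr_sum mulr_suml; apply: eq_bigr => l _.
have li := ltn_ord l; rewrite IH ?coef_poly; last by lia.
rewrite (_ : i - l < N)%N; last by lia.
by rewrite -mulrA -exprD subnKC.
Qed.

Lemma coef_lin_exp (b : K) (m j : nat) :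
  ((1 + b *: 'X) ^+ m)`_j = 'C(m, j)%:R * b ^+ j.
Proof.
rewrite addrC exprD1n coef_sum.
have [jm|mj] := leqP j m.
  have jm' : (j < m.+1)%N by [].
  rewrite (bigD1 (Ordinal jm')) //= big1 => [|i ij].
    by rewrite addr0 coefMn exprZn coefZ coefXn eqxx mulr1 mulr_natl.
  rewrite coefMn exprZn coefZ coefXn.
  rewrite (_ : j == i = false) ?mulr0 ?mul0rn //.
  by apply/eqP => e; case/eqP: ij; apply: val_inj.
rewrite big1 ?bin_small ?mul0r // => i _.
rewrite coefMn exprZn coefZ coefXn.
by rewrite (_ : j == i = false) ?mulr0 ?mul0rn //; have := ltn_ord i; lia.
Qed.

End Geometric.

Arguments geom {K} N c.
Arguments geom_inverse {K} N c.

Lemma gbin_nat (m t : nat) : (t <= m)%N -> gbin m%:Z t = 'C(m, t)%:R.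
Proof.
move=> tm; rewrite /gbin (_ : \prod_(i < t) _ = (m ^_ t)%:Z).
  rewrite -bin_ffact PoszM intrM mulfK // Num.Theory.pnatr_eq0; have := fact_gt0 t; lia.
rewrite ffact_prod (big_morph Posz PoszM erefl); apply: eq_bigr => i _.
by rewrite subzn //; have := ltn_ord i; lia.
Qed.

(** For [k = 0] the bound forces [t = 0], and the value [gbin (-1) 0 = 1] enters; for [k > 0] the
    upper argument is a natural number. *)
Lemma coef_geom1_exp (K : comAlgType rat) (N k t : nat) : (t < N)%N -> (t <= k)%N ->
  (geom N (1 : K) ^+ k)`_t = (gbin ((k + t)%:Z - 1) t)%:A.
Proof.
move=> tN; case: k => [|k] tk.
  have -> : t = 0%N by lia.
  by rewrite expr0 coef1 /gbin big_ord0 divr1 scale1r.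
rewrite coef_geom_exp // expr1n mulr1 (_ : (k.+1 + t)%:Z - 1 = (k + t)%:Z); last by lia.
by rewrite gbin_nat ?scaler_nat //; lia.
Qed.

(** * Large Narayana polynomials as coefficients of powers of [nphi] *)

Lemma large_narayana_atE (A : comAlgType rat) (n : nat) (x : A) : (0 < n)%N ->
  large_narayana_at n x =
  \sum_(k < n) (n%:R^-1 * 'C(n, k)%:R * 'C(n, k.+1)%:R) *: x ^+ k.+1.
Proof.
case: n => // n _; rewrite /large_narayana_at /large_narayana /narayana.
rewrite rmorphM /= horner_algX big_add1 big_mkord rmorph_sum mulr_sumr.
apply: eq_bigr => k _ /=.
rewrite linearZ /= rmorphXn /= horner_algX.
by rewrite mulr_algl -scalerAr -exprS.
Qed.

(* The series [(1 + (x - 1) X) / (1 - X)]. *)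
Definition nphi {K : comNzRingType} (N : nat) (x : K) : {poly K} :=
  (1 + (x - 1) *: 'X) * geom N 1.

Lemma large_narayana_coef (K : comAlgType rat) (N n : nat) (x : K) : (n < N)%N ->
  n.+1%:R * large_narayana_at n x = (nphi N x ^+ n.+1)`_n.
Proof.
move=> nN.
(* Modulo [X^N], [nphi] is [1 + x X / (1 - X)], which the binomial theorem expands in powers of
   [x]. *)
have -> : (nphi N x ^+ n.+1)`_n = ((x *: ('X * geom N 1) + 1) ^+ n.+1)`_n.
  apply: (@eq_uptoX _ N) => // i iN.
  rewrite [RHS]coefD -(geom_inverse N 1 i iN) -coefD /nphi -!mul_polyC polyCB polyC1.
  suff -> : (1 + (x%:P - 1) * 'X) * geom N 1
    = x%:P * ('X * geom N 1) + (1 - 1 * 'X) * geom N 1 by [].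
  by ring.
case: n nN => [|n] nN.
  rewrite /large_narayana_at mul1r rmorph1 expr1 coefD coefZ coefXM coef1.
  by rewrite mulr0 add0r.
rewrite large_narayana_atE // exprD1n coef_sum [in RHS]big_ord_recr /=.
have XgE i : ((x *: ('X * geom N 1)) ^+ i.+1)`_n.+1
    = x ^+ i.+1 * ('X^(i.+1) * geom N 1 ^+ i.+1)`_n.+1.
  by rewrite exprZn exprMn coefZ.
(* Both extreme terms vanish in degree [n.+1]: the first is constant, the last is divisible by
   [X^(n+2)]. *)
rewrite [in RHS]big_ord_recl expr0 !coefMn coef1 mul0rn add0r.
rewrite XgE coefXnM ltnSn mulr0 mul0rn addr0 mulr_sumr.
apply: eq_bigr => i _; have ni := ltn_ord i.
rewrite coefMn XgE coefXnM ltnNge ni /= subSS coef_geom_exp; last by lia.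
rewrite expr1n mulr1 subnKC // bin_sub //.
rewrite -mulrnAr -mulrnA [RHS]mulrC !mulr_ratnat.
rewrite scalerA; congr (_ *: _).
apply: (@mulfI _ n.+1%:R); first by rewrite Num.Theory.pnatr_eq0.
rewrite mulrCA -!mulrA mulVKf ?Num.Theory.pnatr_eq0 // -!natrM; congr (_%:R).
(* Two absorptions turn both sides into [i.+1 * 'C(n.+1, i.+1) * 'C(n.+2, i.+1)]. *)
have := mul_bin_diag n.+1 i; have := mul_bin_diag n.+2 i => /= h1 h2.
by rewrite [RHS]mulnA h2 mulnA h1 mulnAC.
Qed.

(* The inverse of [nphi N q] modulo [X^N]. *)
Definition npsi {K : comNzRingType} (N : nat) (q : K) : {poly K} :=
  (1 - 1 *: 'X) * geom N (1 - q).

Lemma nphi_npsi (K : comNzRingType) (N : nat) (q : K) : eq_upto N (nphi N q * npsi N q) 1.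
Proof.
have -> : nphi N q * npsi N q =
   ((1 - 1 *: 'X) * geom N 1) * ((1 - (1 - q) *: 'X) * geom N (1 - q)).
  rewrite /nphi /npsi -(opprB 1 q) scaleNr; ring.
by rewrite -[X in eq_upto _ _ X](mulr1 1); apply: eq_uptoM; apply: geom_inverse.
Qed.

(** * The summation formula over a commutative rational algebra *)

Section Summation.
Variables (K : comAlgType rat) (n : nat) (q q' : K).

Lemma large_narayana_series :
  eq_upto n.+1 (\sum_(m < n.+1) large_narayana_at m q *: ('X^m * npsi n.+1 q ^+ m.+1)) 1.
Proof.
have nphi0 : (nphi n.+1 q)`_0 = 1.
  by rewrite coefM big_ord1 coefD coefZ coefX mulr0 addr0 coef1 coef_poly mulr1.
apply: (lagrange_inversion _ _ _ _ nphi0 (nphi_npsi _ _ _)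
  (fun m => large_narayana_at m q)).
by move=> m; apply: large_narayana_coef.
Qed.

(** The [n-k+1] factors [1 - X] of the [npsi] power cancel against the denominator of the [nphi]
    power and leave [1 / (1 - X)^k]. The indices [i], [j], [k - i - j] are the degrees taken from
    [1 / (1 - (1-q) X)^(n-k+1)], [(1 + (q'-1) X)^(n+1)] and [1 / (1 - X)^k]. *)
Lemma inner_sum_coef (k : nat) : (k <= n)%N ->
  \sum_(0 <= i < k.+1) \sum_(0 <= j < k.+1 | (i + j <= k)%N)
      ('C(n - k + i, i)%:R * 'C(n.+1, j)%:R
         * gbin ((2 * k)%:Z - i%:Z - j%:Z - 1) (k - i - j)) *:
      ((1 - q) ^+ i * (q' - 1) ^+ j)
  = (nphi n.+1 q' ^+ n.+1 * npsi n.+1 q ^+ (n - k).+1)`_k.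
Proof.
move=> kn.
have -> : (nphi n.+1 q' ^+ n.+1 * npsi n.+1 q ^+ (n - k).+1)`_k =
   (geom n.+1 (1 - q) ^+ (n - k).+1 *
      ((1 + (q' - 1) *: 'X) ^+ n.+1 * geom n.+1 1 ^+ k))`_k.
  have -> : nphi n.+1 q' ^+ n.+1 * npsi n.+1 q ^+ (n - k).+1 =
   (geom n.+1 (1 - q) ^+ (n - k).+1 *
      ((1 + (q' - 1) *: 'X) ^+ n.+1 * geom n.+1 1 ^+ k))
    * ((1 - 1 *: 'X) * geom n.+1 1) ^+ (n - k).+1.
    rewrite /nphi /npsi !exprMn.
    rewrite (_ : geom n.+1 1 ^+ n.+1 = geom n.+1 1 ^+ k * geom n.+1 1 ^+ (n - k).+1).
      by ring.
    by rewrite -exprD; congr (_ ^+ _); lia.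
  rewrite -[in RHS](mulr1 (_ * (_ * _))).
  have := eq_uptoX (n - k).+1 (geom_inverse n.+1 (1 : K)); rewrite expr1n => h.
  by apply: (@eq_uptoM _ n.+1).
rewrite coefM big_mkord; apply: eq_bigr => i _; have ik := ltn_ord i.
rewrite coef_geom_exp; last by lia.
rewrite coefM mulr_sumr big_mkord.
rewrite (eq_bigl (fun j : 'I_k.+1 => (j < (k - i).+1)%N)); last by move=> j; lia.
have ki : ((k - i).+1 <= k.+1)%N by lia.
set F := fun j : nat => ('C(n - k + i, i)%:R * 'C(n.+1, j)%:R
         * gbin ((2 * k)%:Z - i%:Z - j%:Z - 1) (k - i - j)) *:
      ((1 - q) ^+ i * (q' - 1) ^+ j).
rewrite -(big_ord_widen _ F ki); apply: eq_bigr => j _; have jk := ltn_ord j.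
rewrite coef_lin_exp coef_geom1_exp; try lia.
rewrite /F (_ : (2 * k)%:Z - i%:Z - j%:Z - 1 = (k + (k - i - j))%:Z - 1); last by lia.
rewrite mulr_algr !mulr_ratnat -scalerAl -!scalerAr !scalerA.
by congr (_ *: _); ring.
Qed.

Lemma large_narayana_summation :
  n.+1%:R * large_narayana_at n q' =
  \sum_(0 <= k < n.+1)
    large_narayana_at (n - k) q *
    \sum_(0 <= i < k.+1) \sum_(0 <= j < k.+1 | (i + j <= k)%N)
      ('C(n - k + i, i)%:R * 'C(n.+1, j)%:R
         * gbin ((2 * k)%:Z - i%:Z - j%:Z - 1) (k - i - j)) *:
      ((1 - q) ^+ i * (q' - 1) ^+ j).
Proof.
rewrite (large_narayana_coef _ n.+1) // -[nphi n.+1 q' ^+ _]mulr1.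
have -> : (nphi n.+1 q' ^+ n.+1 * 1)`_n = (nphi n.+1 q' ^+ n.+1 *
   \sum_(m < n.+1) large_narayana_at m q *: ('X^m * npsi n.+1 q ^+ m.+1))`_n.
  by symmetry; apply: (@eq_uptoM _ n.+1) => //; apply: large_narayana_series.
(* With [m = n - k], the factor [X^m] shifts the coefficient of degree [n] to degree [k]. *)
rewrite mulr_sumr coef_sum (reindex_inj rev_ord_inj) /= big_mkord.
apply: eq_bigr => k _; have kn := ltn_ord k.
rewrite inner_sum_coef; last by lia.
rewrite subSS -scalerAr coefZ mulrCA coefXnM.
by rewrite (_ : n < n - k = false)%N ?subKn //; lia.
Qed.

End Summation.

Theorem theorem6 (n : nat) (n_gt0 : (0 < n)%N) :
  let q : {mpoly rat[2]} := 'X_ord0 in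
  let q' : {mpoly rat[2]} := 'X_ord_max in
  n.+1%:R * large_narayana_at n q' =
  \sum_(0 <= k < n.+1)
    large_narayana_at (n - k) q *
    \sum_(0 <= i < k.+1) \sum_(0 <= j < k.+1 | (i + j <= k)%N)
      ('C(n - k + i, i)%:R * 'C(n.+1, j)%:R
         * gbin ((2 * k)%:Z - i%:Z - j%:Z - 1) (k - i - j)) *:
      ((1 - q) ^+ i * (q' - 1) ^+ j).
Proof. exact: large_narayana_summation. Qed.
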